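(* Let $(X,d)$ be an unbounded metric space and let $p\in X$. Then the following statements are equivalent: (i) The set $Sp(X)=\{d(x,p): x\in X\}$ is nonporous at infinity, i.e. $p^{+}(Sp(X),\infty)=0$. (ii) For every scaling sequence $\tilde r=(r_n)_{n\in\mathbb N}$ and every subsequence $\tilde r'=(r_{n_k})_{k\in\mathbb N}$ of $\tilde r$ (with $n_1<n_2<\dots$), the mapping $\boldsymbol\varphi^{\tilde r'}: Seq(X,\tilde r)\to Seq(X,\tilde r')$, $(x_n)_{n\in\mathbb N}\mapsto (x_{n_k})_{k\in\mathbb N}$, is a surjection. (iii) The equality $Sp(\mathbf\Omega^X_{\infty,\tilde r_1})=Sp(\mathbf\Omega^X_{\infty,\tilde r_2})$ holds for any two scaling sequences $\tilde r_1$ and $\tilde r_2$, where for $i=1,2$ $$Sp(\mathbf\Omega^X_{\infty,\tilde r_i})=\{\boldsymbol\rho_i(\nu,\nu_{0,\tilde r_i}):\nu\in\mathbf\Omega^X_{\infty,\tilde r_i}\}.$$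
   Context: A scaling sequence is a sequence $\tilde r=(r_n)_{n\in\mathbb N}$ of positive real numbers with $\lim_{n\to\infty} r_n=\infty$. $Seq(X,\tilde r)$ is the set of all sequences $\tilde x=(x_n)_{n\in\mathbb N}$ of points of $X$ for which the limit $\tilde d_{\tilde r}(\tilde x)=\lim_{n\to\infty} d(x_n,p)/r_n$ exists and is finite. The function $d^{\tilde r}(\tilde x,\tilde y)=\limsup_{n\to\infty} d(x_n,y_n)/r_n$ is a pseudometric on $Seq(X,\tilde r)$. $(\mathbf\Omega^X_{\infty,\tilde r},\boldsymbol\rho)$ denotes the metric identification of $(Seq(X,\tilde r),d^{\tilde r})$, i.e. the quotient set by the relation $d^{\tilde r}(\tilde x,\tilde y)=0$ with the induced metric; for $\tilde r=\tilde r_i$ the metric is written $\boldsymbol\rho_i$. The set $\nu_{0,\tilde r}=\{\tilde x\in Seq(X,\tilde r):\tilde d_{\tilde r}(\tilde x)=0\}$ is a point of $\mathbf\Omega^X_{\infty,\tilde r}$ (its distinguished point). For $E\subseteq\mathbb R_+=[0,\infty)$, the porosity of $E$ at infinity is $p^+(E,\infty)=\limsup_{h\to\infty} l(\infty,h,E)/h$, where $l(\infty,h,E)$ is the length of the longest interval in $[0,h]\setminus E$. $E$ is nonporous at infinity if $p^+(E,\infty)=0$. *)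

(* Defs.v *)
From HB Require Import structures.
From mathcomp Require Import all_boot all_order all_algebra.
From mathcomp Require Import all_classical all_reals all_analysis.
Set Implicit Arguments.
Unset Strict Implicit.
Unset Printing Implicit Defensive.
Import Order.TTheory GRing.Theory Num.Theory.
Import numFieldNormedType.Exports.
Local Open Scope classical_set_scope.
Local Open Scope ring_scope.

Definition unbounded_space (R : realType) (X : metricType R) : Prop :=
  forall M : R, exists x y : X, M < mdist x y.

Section porosity.
Context {R : realType}.
Implicit Types (E : set R) (h : R).

(* Open, closed, half-open and degenerate intervals all compete.  The set of
   lengths contains 0 (empty interval, as [sup set0 = inf set0 = 0]) and is
   bounded by [h] when [0 <= h].  The maximum is attained, so [sup] is the
   length of the longest interval. *)
Definition longest_gap h E : R :=
  sup [set sup I - inf I | I in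
    [set I : set R | is_interval I /\ I `<=` `[0, h] `\` E]].

Definition porosity_infty E : \bar R :=
  limf_esup (fun h => (longest_gap h E / h)%:E) (pinfty_nbhs R).

Definition nonporous_infty E : Prop := porosity_infty E = 0%E.

End porosity.

Definition scaling_sequence (R : realType) (r : nat -> R) : Prop :=
  (forall n, 0 < r n) /\ r n @[n --> \oo] --> +oo.

(* The set of distances to [p] in the (pseudo)metric space [(A, d)]. *)
Definition Sp (R : realType) (T : Type) (A : set T) (d : T -> T -> R) (p : T) :
  set R := [set d x p | x in A].

Lemma le_limn_sup (R : realType) (u v : nat -> R) :
  bounded_fun u -> bounded_fun v -> (forall n, u n <= v n) ->
  limn_sup u <= limn_sup v.
Proof.
move=> bu bv uv.
have cvs (w : nat -> R) : bounded_fun w -> cvgn (sups w).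
  move=> bw; apply: nonincreasing_is_cvgn; last exact: bounded_fun_has_lbound_sups.
  exact/nonincreasing_sups/bounded_fun_has_ubound.
apply: ler_lim; [exact: cvs|exact: cvs|apply: nearW => n].
apply: ge_sup => [|_ [m /= nm <-]]; first by exists (u n); exists n => /=.
apply: (le_trans (uv m)); apply: ub_le_sup; last by exists m.
exact/has_ubound_sdrop/bounded_fun_has_ubound.
Qed.

Section pretangent.
Context {R : realType} {X : metricType R}.
Variable p : X.
Implicit Types (r : nat -> R) (x y : nat -> X) (nu mu : set (nat -> X)).

(* Convergence is in [R], so that the limit is finite. *)
Definition Seq r : set (nat -> X) :=
  [set x | cvg (mdist (x n) p / r n @[n --> \oo])].

Definition dist_to_base r x : R := limn (fun n => mdist (x n) p / r n).

(* Meaningful on [Seq r], where the sequence of quotients is bounded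
   ([quotient_bounded] below). *)
Definition dseq r x y : R := limn_sup (fun n => mdist (x n) (y n) / r n).

Definition dclass r x : set (nat -> X) := [set y | Seq r y /\ dseq r x y = 0].

Definition Omega r : set (set (nat -> X)) := [set dclass r x | x in Seq r].

(* The value does not depend on the chosen representatives ([rhoE] below). *)
Definition rho r nu mu : R :=
  dseq r (xget (fun=> p) nu) (xget (fun=> p) mu).

Definition nu0 r : set (nat -> X) := [set x | Seq r x /\ dist_to_base r x = 0].

Definition phi (k : nat -> nat) x : nat -> X := x \o k.

Lemma quotient_bounded r x y : scaling_sequence r -> Seq r x -> Seq r y ->
  bounded_fun (fun n => mdist (x n) (y n) / r n).
Proof.
move=> [r0 _] /cvg_seq_bounded + /cvg_seq_bounded.
move=> [M [Mr HM]] [N [Nr HN]].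
exists (`|M| + 1 + (`|N| + 1)); split; first exact: num_real.
move=> e /ltW le n _; apply: le_trans le.
have M1 : M < `|M| + 1 by rewrite ltr_pwDr// ler_norm.
have N1 : N < `|N| + 1 by rewrite ltr_pwDr// ler_norm.
have q0 (u v : X) : 0 <= mdist u v / r n by rewrite divr_ge0 ?mdist_ge0// ltW.
have /= := HM _ M1 n I; have /= := HN _ N1 n I.
rewrite !(ger0_norm (q0 _ _)) => hN hM; apply: le_trans (lerD hM hN).
by rewrite -mulrDl ler_pM2r ?invr_gt0// (metric_sym (y n)) metric_triangle.
Qed.

Lemma dseqxx r x : dseq r x x = 0.
Proof.
rewrite /dseq (_ : (fun n => _) = cst 0).
  by apply: (cvg_limn_inf_sup _).2; exact: cvg_cst.
by apply/funext => n; rewrite mdistxx mul0r.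
Qed.

Lemma dseq_ge0 r x y : scaling_sequence r -> Seq r x -> Seq r y ->
  0 <= dseq r x y.
Proof.
move=> rs xs ys; rewrite -(dseqxx r x).
apply: le_limn_sup; [exact: quotient_bounded..|move=> n].
by rewrite mdistxx mul0r divr_ge0 ?mdist_ge0// ltW//; case: rs.
Qed.

Lemma dseqC r x y : dseq r x y = dseq r y x.
Proof.
by rewrite /dseq; congr limn_sup; apply/funext => n; rewrite metric_sym.
Qed.

Lemma dseq_triangle r y x z : scaling_sequence r ->
  Seq r x -> Seq r y -> Seq r z -> dseq r x z <= dseq r x y + dseq r y z.
Proof.
move=> rs xs ys zs; have [r0 _] := rs.
apply: le_trans (le_limn_supD (quotient_bounded rs xs ys)
  (quotient_bounded rs ys zs)).
apply: le_limn_sup => [||n]; first exact: quotient_bounded.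
  exact: bounded_funD (quotient_bounded rs xs ys) (quotient_bounded rs ys zs).
by rewrite /= -mulrDl ler_pM2r ?invr_gt0// metric_triangle.
Qed.

Lemma Seq_base r : Seq r (fun=> p).
Proof.
rewrite /Seq/=; under eq_fun do rewrite mdistxx mul0r.
exact: is_cvg_cst.
Qed.

Lemma dseq_base r x : Seq r x -> dseq r x (fun=> p) = dist_to_base r x.
Proof. by move=> /cvg_limn_supE. Qed.

Lemma nu0E r : nu0 r = dclass r (fun=> p).
Proof.
apply/seteqP; split=> x /= [xs x0]; split=> //; move: x0.
  by rewrite -dseq_base// dseqC.
by rewrite dseqC dseq_base.
Qed.

Lemma Omega_nu0 r : Omega r (nu0 r).
Proof. by exists (fun=> p); [exact: Seq_base|rewrite nu0E]. Qed.

Lemma rhoE r nu mu x y : scaling_sequence r -> Omega r nu -> Omega r mu ->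
  nu x -> mu y -> rho r nu mu = dseq r x y.
Proof.
move=> rs + + nux muy.
have aux la a : Omega r la -> la a ->
    let b := xget (fun=> p) la in [/\ Seq r a, Seq r b & dseq r a b = 0].
  move=> [c cs <-] [as_ ca0] /=.
  have [bs cb0] : dclass r c (xget (fun=> p) (dclass r c)).
    by apply: (@xgetPex _ (fun=> p)); exists a; split.
  split=> //; apply/eqP; rewrite eq_le dseq_ge0// andbT.
  by rewrite (le_trans (dseq_triangle rs as_ cs bs))// cb0 dseqC ca0 addr0.
move=> /aux /(_ nux) [xs x's xx'] /aux /(_ muy) [ys y's yy'].
rewrite /rho; set x' := xget _ nu in x's xx' *; set y' := xget _ mu in y's yy' *.
apply/eqP; rewrite eq_le; apply/andP; split.
- rewrite (le_trans (dseq_triangle rs x's xs y's))// dseqC xx' add0r.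
  by rewrite (le_trans (dseq_triangle rs xs ys y's))// yy' addr0.
- rewrite (le_trans (dseq_triangle rs xs x's ys))// xx' add0r.
  by rewrite (le_trans (dseq_triangle rs x's y's ys))// (dseqC r y') yy' addr0.
Qed.

Lemma phi_Seq r k : increasing_seq k -> set_fun (Seq r) (Seq (r \o k)) (phi k).
Proof.
move=> kinc x /= xs.
have kh : {homo k : m n / (m < n)%N} 
  by move=> m n; rewrite !ltnNge -(kinc n m) leEnat.
have kge n : (n <= k n)%N.
  by elim: n => // n ih; apply: leq_ltn_trans ih (kh _ _ _).
have koo : k n @[n --> \oo] --> \oo.
  move=> A [N _ NA]; exists N => // n /= Nn; apply: NA => /=.
  exact: leq_trans Nn (kge n).
apply/cvg_ex; exists (dist_to_base r x).
exact: (cvg_comp _ _ koo xs).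
Qed.

End pretangent.

(* Main.v *)
(* Nonporosity of [Sp X] at infinity means that [Sp X] is relatively dense: every
   large [h] lies within [e * h] of some distance to [p].  Then some
   [g : R -> X] satisfies [d (g t, p) / t --> 1], so [n |-> g (L * r n)] realizes
   any prescribed distance [L > 0]: hence [Sp Omega] is always [0, +oo[, and a
   sequence along a subsequence of scales can be completed at the other scales.
   Otherwise there are scales [h n --> +oo] whose rescaled spectra all avoid one
   fixed neighbourhood of [1], whereas the scales [d (s n, p)] with
   [s n --> oo] realize the distance [1].  The two kinds of scales give different
   [Sp Omega], and interleaving them violates surjectivity. *)
Require Import Defs.
From mathcomp Require Import all_boot all_order all_algebra.
From mathcomp Require Import all_classical all_reals all_analysis.
From mathcomp Require Import lra.
Set Implicit Arguments.
Unset Strict Implicit.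
Unset Printing Implicit Defensive.
Import Order.TTheory GRing.Theory Num.Theory.
Import numFieldNormedType.Exports.
Local Open Scope classical_set_scope.
Local Open Scope ring_scope.

(** * Bounds on a limit superior along a filter *)

Lemma limf_esup_lt (R : realType) (T : choiceType) (Y : filteredType T)
    (F : set_system Y) {FF : Filter F} (f : Y -> \bar R) (c : \bar R) :
  (limf_esup f F < c)%E -> \forall x \near F, (f x < c)%E.
Proof.
move=> /ereal_inf_lt[_ [V FV <-] Vc].
apply: filterS FV => x Vx; apply: le_lt_trans Vc.
by apply: ereal_sup_ubound; exists x.
Qed.

Lemma limf_esup_le (R : realType) (T : choiceType) (Y : filteredType T)
    (F : set_system Y) (f : Y -> \bar R) (c : \bar R) :
  (\forall x \near F, (f x <= c)%E) -> (limf_esup f F <= c)%E.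
Proof.
move=> fc; apply: (@le_trans _ _ (ereal_sup (f @` [set x | (f x <= c)%E]))).
  by apply: ereal_inf_lbound; exists [set x | (f x <= c)%E].
by apply: ge_ereal_sup => _ [x xc <-].
Qed.

(** * Porosity at infinity and relative density *)

Section gaps.
Context {R : realType}.
Implicit Types (E I : set R) (a b h e : R).

(** An interval contains every point strictly between its infimum and supremum, so a point of [E]
    there cannot be avoided. The bounds on [s] are strict because the endpoints may be missing. *)
Lemma longest_gap_le E h e :
  0 <= e ->
  (forall a b, 0 <= a -> b <= h -> e < b - a -> exists2 s, E s & a < s < b) ->
  longest_gap h E <= e.
Proof.
move=> e0 He; apply: ge_sup.
  exists 0, set0; last by rewrite sup0 inf0 subrr.
  by split => [x y|x].
move=> _ [I [iI IE] <-]; rewrite leNgt; apply/negP => eI.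
have [I0|/set0P I0] := eqVneq I set0.
  by move: eI; rewrite I0 sup0 inf0 subrr ltNge e0.
have I0h x : I x -> 0 <= x <= h by move=> /IE[/=]; rewrite in_itv.
have hsI : has_sup I by split => //; exists h => x /I0h/andP[].
have hiI : has_inf I by split => //; exists 0 => x /I0h/andP[].
have [||s Es /andP[Is sI]] := He (inf I) (sup I) _ _ eI.
- by apply: lb_le_inf => // x /I0h/andP[].
- by apply: ge_sup => // x /I0h/andP[].
have [u Iu us] := inf_lt I0 Is; have [v Iv sv] := sup_gt I0 sI.
have /IE[] // : I s by apply: (iI u v) => //; rewrite (ltW us) (ltW sv).
Qed.

Lemma le_longest_gap E I h : 0 <= h -> is_interval I ->
  I `<=` `[0, h] `\` E -> sup I - inf I <= longest_gap h E.
Proof.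
move=> h0 iI IE; apply: ub_le_sup; last by exists I.
exists h => _ [J [_ JE] <-].
(* The empty interval has length 0, which is where [0 <= h] enters. *)
have [->|/set0P J0] := eqVneq J set0; first by rewrite sup0 inf0 subrr.
have J0h x : J x -> 0 <= x <= h by move=> /JE[/=]; rewrite in_itv.
have : sup J <= h by apply: ge_sup => // x /J0h/andP[].
have : 0 <= inf J by apply: lb_le_inf => // x /J0h/andP[].
lra.
Qed.

(** The pivot to which all three statements are reduced. The error is proportional to [h], not
    uniform. *)
Definition relatively_dense_infty E := forall e, 0 < e ->
  \forall h \near +oo, exists2 s, E s & `|s - h| <= e * h.

Lemma nonporous_relatively_dense E :
  nonporous_infty E -> relatively_dense_infty E.
Proof.
move=> pE e e0; pose d := Num.min e 2^-1.
have d0 : 0 < d by rewrite lt_min e0 invr_gt0 ltr0n.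
have de : d <= e by rewrite ge_min lexx.
have d1 : d <= 2^-1 by rewrite ge_min lexx orbT.
have /limf_esup_lt : (limf_esup (fun h => (longest_gap h E / h)%:E)
    (pinfty_nbhs R) < d%:E)%E.
  by have := pE; rewrite /nonporous_infty /porosity_infty => ->; rewrite lte_fin.
move=> H; near=> h.
have h0 : 0 < h by near: h; exact: nbhs_pinfty_gt.
have : ((longest_gap h E / h)%:E < d%:E)%E by near: h; exact: H.
rewrite lte_fin ltr_pdivrMr// ltNge => /negP gapE.
apply: contrapT => nE; apply: gapE.
have dh : d * h <= 2^-1 * h by rewrite ler_pM2r.
have deh : d * h <= e * h by rewrite ler_pM2r.
have dh0 : 0 < d * h by rewrite mulr_gt0.
have dhh : h - d * h <= h by lra.
rewrite [leLHS](_ : _ = sup `[h - d * h, h] - inf `[h - d * h, h]); last first.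
  by rewrite sup_itvcc// inf_itvcc//; lra.
apply: le_longest_gap; [exact: ltW|exact: interval_is_interval|].
move=> s /=; rewrite !in_itv/= => sh; split; first by lra.
move=> Es; apply: nE; exists s => //.
by rewrite ler_norml; lra.
Unshelve. all: by end_near. Qed.

(** Density with error [e / 3] at the midpoint of a gap longer than [e * h] yields a point of [E]
    less than half a length away, hence inside the gap. *)
Lemma relatively_dense_nonporous E :
  relatively_dense_infty E -> nonporous_infty E.
Proof.
move=> dE; rewrite /nonporous_infty /porosity_infty; apply/eqP; rewrite eq_le.
apply/andP; split; last first.
  rewrite leNgt; apply/negP => /limf_esup_lt H.
  have [h [+ h0]] := filter_ex (filterI H (nbhs_pinfty_gt (num_real (0 : R)))).
  rewrite lte_fin ltNge => /negP; apply; rewrite divr_ge0 ?(ltW h0)//.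
  (* The empty gap shows that the porosity is not negative. *)
  rewrite -(subrr (0 : R)) -[X in X - _]sup0 -[X in _ - X]inf0.
  apply: le_longest_gap (ltW h0) _ _; [by move=> x y|by move=> x].
apply/lee_addgt0Pr => e e0; rewrite add0e; apply: limf_esup_le.
have e3 : 0 < e / 3 by rewrite divr_gt0.
have [M [Mr HM]] := dE _ e3.
near=> h.
have h0 : 0 < h by near: h; exact: nbhs_pinfty_gt.
have eh0 : 0 < e * h by rewrite mulr_gt0.
(* The midpoint of such a gap exceeds [e / 2 * h], hence lies in the range where density applies. *)
have Mh : M < e / 2 * h.
  rewrite mulrC -ltr_pdivrMr ?divr_gt0//; near: h; apply: nbhs_pinfty_gt.
  exact: num_real.
rewrite lee_fin ler_pdivrMr//; apply: longest_gap_le; first exact: ltW.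
move=> a b a0 bh eab; have [|s Es sm] := HM ((a + b) / 2); first by lra.
exists s => //; have : e / 3 * ((a + b) / 2) <= e / 3 * h.
  by rewrite ler_pM2l//; lra.
move: sm; rewrite ler_norml; lra.
Unshelve. all: by end_near. Qed.

End gaps.

(** * Spectra of pretangent spaces and prescribed limits *)

Section spheres.
Context {R : realType} {X : metricType R}.
Variable p : X.
Implicit Types (r : nat -> R) (L : R).

(** [nu0] is the class of the constant sequence [p], so the distance to it is the limit of the
    quotients, whose existence already gives membership in [Seq]. *)
Lemma Sp_OmegaE r : scaling_sequence r ->
  Sp (Omega p r) (rho p r) (nu0 p r) =
  [set L | exists x : nat -> X, mdist (x n) p / r n @[n --> \oo] --> L].
Proof.
move=> rs.
have rho_nu0 x : Seq p r x ->
    rho p r (dclass p r x) (nu0 p r) = dist_to_base p r x.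
  move=> xs; rewrite -(dseq_base xs); apply: (rhoE rs).
  - by exists x.
  - exact: Omega_nu0.
  - by split=> //; exact: dseqxx.
  - by rewrite nu0E; split; [exact: Seq_base|exact: dseqxx].
apply/seteqP; split => [_ [_ [x xs <-] <-]|L [x xL]].
  by exists x; rewrite rho_nu0.
have xs : Seq p r x by apply/cvg_ex; exists L.
exists (dclass p r x); first by exists x.
by rewrite rho_nu0//; exact: cvg_lim.
Qed.

Lemma scaling_sequence_ge r : (forall n, n.+1%:R <= r n) -> scaling_sequence r.
Proof.
move=> rge; split=> [n|]; first by apply: lt_le_trans (rge n); rewrite ltr0n.
apply: (ger_cvgy _ cvgr_idn); apply: nearW => n.
by apply: le_trans (rge n); rewrite ler_nat.
Qed.

Lemma relatively_dense_asymptotic :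
  relatively_dense_infty (Sp [set: X] mdist p) ->
  exists g : R -> X, mdist (g t) p / t @[t --> +oo] --> (1 : R).
Proof.
move=> dE.
(* The closest distance to [t] need not be attained; the slack 1 vanishes after division by [t]. *)
have /choice[g gP] : forall t : R, exists x : X,
    forall y, `|mdist x p - t| < `|mdist y p - t| + 1.
  move=> t; pose D := [set `|mdist y p - t| | y in [set: X]].
  have D0 : has_lbound D by exists 0 => _ [y _ <-].
  have [|_ [x _ <-] xD] := @inf_adherent _ D 1 ltr01.
    by split => //; exists `|mdist p p - t|, p.
  exists x => y; apply: lt_le_trans xD _; rewrite lerD2r.
  by apply: ge_inf => //; exists y.
exists g; apply/cvgrPdist_le => e e0.
have e2 : 0 < e / 2 by rewrite divr_gt0.
have H := dE _ e2; near=> t.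
have t0 : 0 < t by near: t; exact: nbhs_pinfty_gt.
have te : 1 < e / 2 * t.
  by rewrite mulrC -ltr_pdivrMr//; near: t; apply: nbhs_pinfty_gt; exact: num_real.
have [_ [y _ <-] yt] : exists2 s, Sp [set: X] mdist p s & `|s - t| <= e / 2 * t.
  by near: t.
rewrite -(divff (lt0r_neq0 t0)) -mulrBl normrM normfV (gtr0_norm t0).
rewrite ler_pdivrMr// distrC.
have := gP t y; lra.
Unshelve. all: by end_near. Qed.

Lemma relatively_dense_attains r L :
  relatively_dense_infty (Sp [set: X] mdist p) -> scaling_sequence r -> 0 <= L ->
  exists x : nat -> X, mdist (x n) p / r n @[n --> \oo] --> L.
Proof.
move=> /relatively_dense_asymptotic[g g1] [r0 roo].
(* For [L = 0] the points [g (L * r n)] would not go to infinity; the constant sequence serves. *)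
rewrite le_eqVlt => /predU1P[<-|L0].
  by exists (fun=> p); under eq_fun do rewrite mdistxx mul0r; exact: cvg_cst.
exists (fun n => g (L * r n)).
have Lroo : L * r n @[n --> \oo] --> +oo.
  apply/cvgryPge => A; have /cvgryPge/(_ (A / L)) := roo.
  by apply: filterS => n; rewrite ler_pdivrMr// mulrC.
rewrite -[X in _ --> X]mul1r.
rewrite (_ : (fun n => _) = fun n => mdist (g (L * r n)) p / (L * r n) * L).
  by apply: cvgM; [exact: (cvg_comp _ _ Lroo g1)|exact: cvg_cst].
by apply/funext => n; rewrite invfM (mulrC L^-1) mulrA mulfVK// gt_eqF.
Qed.

(** * Relative density against surjectivity and equality of spectra *)

Lemma unbounded_far_points : unbounded_space X ->
  exists s : nat -> X, forall n, n.+1%:R <= mdist (s n) p.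
Proof.
move=> Xunb; suff /choice[s sP] : forall n, exists x, n.+1%:R <= mdist x p by exists s.
move=> n; have [x [y xy]] := Xunb (n.+1%:R + n.+1%:R).
(* Two points more than [2 * (n + 1)] apart cannot both be closer than [n + 1] to [p]. *)
have [xp|xp] := leP n.+1%:R (mdist x p); first by exists x.
exists y; have := metric_triangle x p y; rewrite (metric_sym p); lra.
Qed.

Lemma not_relatively_dense_gaps :
  ~ relatively_dense_infty (Sp [set: X] mdist p) ->
  exists (e : R) (h : nat -> R), [/\ 0 < e, forall n, n.+1%:R <= h n &
    forall n x, e < `|mdist x p / h n - 1|].
Proof.
move=> /existsNP[e /not_implyP[e0 nH]].
have : forall n, exists h : R, n.+1%:R <= h /\ forall x, e < `|mdist x p / h - 1|.
  move=> n; apply: contrapT => /forallNP nh; apply: nH; near=> h.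
  have nh' : n.+1%:R <= h by near: h; apply: nbhs_pinfty_ge; exact: num_real.
  have h0 : 0 < h by apply: lt_le_trans nh'; rewrite ltr0n.
  have /not_andP[//|/existsNP[x /negP]] := nh h; rewrite -leNgt => xh.
  exists (mdist x p); first by exists x.
  move: xh; rewrite -{1}(divff (lt0r_neq0 h0)) -mulrBl normrM normfV.
  by rewrite (gtr0_norm h0) ler_pdivrMr.
by move=> /choice[h hP]; exists e, h; split=> // n; have [] := hP n.
Unshelve. all: by end_near. Qed.

(** The preimage of [y] follows [y] on the range of [k] and, elsewhere, a sequence [z] with the same
    limit [L]. *)
Lemma relatively_dense_phi_surj r (k : nat -> nat) :
  relatively_dense_infty (Sp [set: X] mdist p) ->
  scaling_sequence r -> increasing_seq k ->
  set_surj (Seq p r) (Seq p (r \o k)) (phi k).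
Proof.
move=> dE rs kinc y ys; pose L := dist_to_base p (r \o k) y.
have L0 : 0 <= L.
  apply: limr_ge; first exact: ys.
  apply: nearW => n; rewrite divr_ge0 ?mdist_ge0//.
  exact: ltW (rs.1 (k n)).
have [z zL] := relatively_dense_attains dE rs L0.
pose kinv n := xget 0%N [set m | k m = n].
pose x n := if `[< exists m, k m = n >] then y (kinv n) else z n.
have kK m : kinv (k m) = m.
  by apply: (incn_inj kinc); exact: (@xgetPex _ 0%N [set i | k i = k m] (ex_intro _ m erefl)).
have xk m : x (k m) = y m.
  by rewrite /x asboolT ?kK//; exists m.
exists x; last by apply/funext => m; exact: xk.
apply/cvg_ex; exists L; apply/cvgrPdist_le => e e0.
have /cvgrPdist_le/(_ e e0)[N _ HN] := zL.
have /cvgrPdist_le/(_ e e0)[M _ HM] : mdist (y n) p / r (k n) @[n --> \oo] --> L.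
  exact: ys.
(* If [n = k m], then [k M <= n] gives [M <= m], as [k] reflects the order. *)
exists (maxn N (k M)) => // n /=; rewrite geq_max => /andP[Nn kMn].
have [[m kmn]|nk] := pselect (exists m, k m = n).
  rewrite -kmn xk; apply: HM => /=.
  by rewrite -kinc leEnat kmn.
by rewrite /x asboolF//; exact: HN.
Qed.

Lemma phi_surj_relatively_dense : unbounded_space X ->
  (forall r (k : nat -> nat), scaling_sequence r -> increasing_seq k ->
    set_surj (Seq p r) (Seq p (r \o k)) (phi k)) ->
  relatively_dense_infty (Sp [set: X] mdist p).
Proof.
move=> /unbounded_far_points[s sP] H.
apply: contrapT => /not_relatively_dense_gaps[e [h [e0 hP he]]].
(* Odd scales realize the distance 1, even scales avoid it; [k] selects the odd ones. *)
pose r n := if odd n then mdist (s n) p else h n.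
pose k n := n.*2.+1.
have rs : scaling_sequence r.
  by apply: scaling_sequence_ge => n; rewrite /r; case: ifP.
have kinc : increasing_seq k by move=> m n; rewrite !leEnat ltnS leq_double.
have sr n : mdist (s (k n)) p / r (k n) = 1.
  rewrite /r /k /= odd_double/= divff// gt_eqF//.
  by apply: lt_le_trans (sP _); rewrite ltr0n.
have [|z zs zk] := H _ _ rs kinc (s \o k).
  by rewrite /Seq/= (_ : (fun n => _) = cst 1); [exact: is_cvg_cst|exact/funext].
have e2 : 0 < e / 2 by rewrite divr_gt0.
have [N _ HN] := (cvgrPdist_le _ _).1 zs _ e2.
have NN : (N <= N.*2)%N by rewrite -addnn leq_addr.
have := HN (k N) (leqW NN); have := HN N.*2 NN.
have -> : z (k N) = s (k N) by have /(congr1 (@^~ N)) := zk.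
rewrite sr /r odd_double !ler_norml.
by have := he N.*2 (z N.*2); rewrite ltr_normr => /orP[]; lra.
Qed.

Lemma Sp_eq_relatively_dense : unbounded_space X ->
  (forall r1 r2, scaling_sequence r1 -> scaling_sequence r2 ->
    Sp (Omega p r1) (rho p r1) (nu0 p r1) =
    Sp (Omega p r2) (rho p r2) (nu0 p r2)) ->
  relatively_dense_infty (Sp [set: X] mdist p).
Proof.
move=> /unbounded_far_points[s sP] H.
apply: contrapT => /not_relatively_dense_gaps[e [h [e0 hP he]]].
have hs := scaling_sequence_ge hP.
have ss := scaling_sequence_ge sP.
have : Sp (Omega p h) (rho p h) (nu0 p h) 1.
  rewrite (H _ _ hs ss) (Sp_OmegaE ss); exists s.
  rewrite (_ : (fun n => _) = cst 1); first exact: cvg_cst.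
  apply/funext => n; rewrite divff// gt_eqF//.
  by apply: lt_le_trans (sP _); rewrite ltr0n.
rewrite (Sp_OmegaE hs) => -[x /cvgrPdist_le/(_ e e0)[N _ /(_ N (leqnn N))]].
by rewrite distrC leNgt he.
Qed.

Lemma relatively_dense_Sp_Omega r :
  relatively_dense_infty (Sp [set: X] mdist p) -> scaling_sequence r ->
  Sp (Omega p r) (rho p r) (nu0 p r) = [set L | 0 <= L].
Proof.
move=> dE rs; rewrite (Sp_OmegaE rs); apply/seteqP; split=> [L [x xL]|L L0].
  rewrite /= -(cvg_lim _ xL)//; apply: limr_ge; first by apply/cvg_ex; exists L.
  by apply: nearW => n; rewrite divr_ge0 ?mdist_ge0//; apply: ltW; case: rs.
exact: relatively_dense_attains.
Qed.

End spheres.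

Theorem theorem5p4 (R : realType) (X : metricType R) (p : X)
    (Xunb : unbounded_space X) :
  let stmt_i := nonporous_infty (Sp [set: X] mdist p) in
  let stmt_ii := forall (r : nat -> R) (k : nat -> nat),
    scaling_sequence r -> increasing_seq k ->
    set_surj (Seq p r) (Seq p (r \o k)) (phi k) in
  let stmt_iii := forall r1 r2 : nat -> R,
    scaling_sequence r1 -> scaling_sequence r2 ->
    Sp (Omega p r1) (rho p r1) (nu0 p r1) =
    Sp (Omega p r2) (rho p r2) (nu0 p r2) in
  (stmt_i <-> stmt_ii) /\ (stmt_ii <-> stmt_iii).
Proof.
move=> stmt_i stmt_ii stmt_iii.
pose dense := relatively_dense_infty (Sp [set: X] mdist p).
have i_dense : stmt_i <-> dense.
  split; [exact: nonporous_relatively_dense|exact: relatively_dense_nonporous].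
have ii_dense : stmt_ii <-> dense.
  split; first exact: phi_surj_relatively_dense.
  by move=> dE r k; exact: relatively_dense_phi_surj.
have iii_dense : stmt_iii <-> dense.
  split; first exact: Sp_eq_relatively_dense.
  by move=> dE r1 r2 r1s r2s; rewrite !relatively_dense_Sp_Omega.
by split; [rewrite i_dense ii_dense|rewrite ii_dense iii_dense].
Qed.
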